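(* The function \[ F_0(k,a,b,c,d,e) = (-1)^{d+e}\,\frac{\Gamma(a+k)\Gamma(b+k)\Gamma(c+k)}{\Gamma(d+k)\Gamma(e+k)\Gamma(a+b+c-d-e+2+k)} \] \[ \times\frac{\Gamma(a+b-d-e+2)\,\Gamma(a+c-d-e+2)\,\Gamma(b+c-d-e+2)}{\Gamma(a-d+1)\Gamma(a-e+1)\Gamma(b-d+1)\Gamma(b-e+1)\Gamma(c-d+1)\Gamma(c-e+1)} \] is a WZ seed in the variables $a,b,c,d,e$.
   Context: A term $F(n_1,\dots,n_r)$ is hypergeometric in $n_1,\dots,n_r$ if each ratio $F(\dots,n_i+1,\dots)/F(\dots,n_i,\dots)$ is a rational function of $n_1,\dots,n_r$. Write $\Delta_n f(n)=f(n+1)-f(n)$. Two hypergeometric terms $F(n,k),G(n,k)$ form a WZ pair, and $G$ is called a WZ mate of $F$, if $\Delta_n F(n,k)=\Delta_k G(n,k)$. A hypergeometric term $F_0(k,a,b,\dots)$ (hypergeometric in $k,a,b,\dots$) is a WZ seed in the variables $a,b,\dots$ if for all integers $K,A,B,\dots$ and all complex $k_0$ and all values of the parameters $a,b,\dots$, the term $F(n,k)=F_0(Kn+k_0+k,\,An+a,\,Bn+b,\dots)$ has a WZ mate $G(n,k)$ (a hypergeometric term). Factors such as $(-1)^x$ or $z^x$ with non-integer exponent $x$ are understood as hypergeometric factors satisfying $(-1)^{x+1}=-(-1)^x$, $z^{x+1}=z\cdot z^x$ (e.g. defined via a fixed branch of the exponential). *)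

(* Defs.v *)
(* Formal (symbolic) hypergeometric terms in two integer
   variables n, k, represented by their two shift ratios, which are
   rational functions in C(n,k) = {fraction {poly {poly C}}}
   (outer polynomial variable = k, inner variable = n). *)
From HB Require Import structures.
From mathcomp Require Import all_boot all_order all_algebra.
From mathcomp Require Import fraction.
Set Implicit Arguments. Unset Strict Implicit. Unset Printing Implicit Defensive.
Import Order.TTheory GRing.Theory Num.Theory.
Local Open Scope ring_scope.

Section HyperTerms.
Variable C : fieldType.

Definition bipoly := {poly {poly C}}.
Definition ratfun := {fraction bipoly}.

Definition tof (p : bipoly) : ratfun := FracField.tofrac p.
Local Notation "x %:F" := (tof x).

Definition varn : bipoly := ('X : {poly C})%:P.
Definition vark : bipoly := 'X.

Definition shiftk (p : bipoly) : bipoly := p \Po ('X + 1).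

Record aff := Aff { aff0 : C; affn : int; affk : int }.
Definition affP (u : aff) : bipoly :=
  (aff0 u)%:P%:P + varn *~ affn u + vark *~ affk u.
Definition aconst (z : C) : aff := Aff z 0 0.
Definition aadd (u v : aff) : aff :=
  Aff (aff0 u + aff0 v) (affn u + affn v) (affk u + affk v).
Definition asub (u v : aff) : aff :=
  Aff (aff0 u - aff0 v) (affn u - affn v) (affk u - affk v).

(* Gamma(u+m)/Gamma(u) = (u)_m for an integer m, as a rational function *)
Definition poch (u : bipoly) (m : int) : ratfun :=
  match m with
  | Posz j => \prod_(i < j) (u + i%:R)%:F
  | Negz j => (\prod_(i < j.+1) (u - i.+1%:R)%:F)^-1
  end.

(* a hypergeometric term in n,k, given by its ratios
   hrn = T(n+1,k)/T(n,k) and hrk = T(n,k+1)/T(n,k) *)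
Record hterm := HT { hrn : ratfun; hrk : ratfun }.
Definition hmul (S T : hterm) : hterm := HT (hrn S * hrn T) (hrk S * hrk T).
Definition hinv (T : hterm) : hterm := HT (hrn T)^-1 (hrk T)^-1.
Definition hdiv (S T : hterm) : hterm := hmul S (hinv T).

Definition GammaT (u : aff) : hterm :=
  HT (poch (affP u) (affn u)) (poch (affP u) (affk u)).
(* the hypergeometric factor (-1)^u, with (-1)^(u+1) = -(-1)^u *)
Definition SignT (u : aff) : hterm :=
  HT ((-1) ^ affn u) ((-1) ^ affk u).

(* T has a WZ mate G: a hypergeometric term G = R * T with R a rational
   function (G(n,k) = P(n,k)/Q(n,k) * T(n,k)), such that
   T(n+1,k) - T(n,k) = G(n,k+1) - G(n,k); dividing by T(n,k) this reads
   hrn T - 1 = R(n,k+1) * hrk T - R(n,k). *)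
Definition has_WZ_mate (T : hterm) : Prop :=
  exists P Q : bipoly, Q != 0 /\
    hrn T - 1 = (shiftk P)%:F / (shiftk Q)%:F * hrk T - P%:F / Q%:F.

(* WZ seed in five parameter variables a,b,c,d,e:
   F(n,k) = F0(K n + k0 + k, A n + a, B n + b, C n + c, D n + d, E n + e) *)
Definition WZ_seed5 (F0 : aff -> aff -> aff -> aff -> aff -> aff -> hterm) : Prop :=
  forall (K A B C' D E : int) (k0 a b c d e : C),
    has_WZ_mate (F0 (Aff k0 K 1) (Aff a A 0) (Aff b B 0) (Aff c C' 0)
                    (Aff d D 0) (Aff e E 0)).

Local Notation "u + v" := (aadd u v).
Local Notation "u - v" := (asub u v).
Local Notation "S * T" := (hmul S T).
Local Notation "S / T" := (hdiv S T).
Local Notation "# z" := (aconst z) (at level 2).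
Local Notation G := GammaT.

Definition F0 (k a b c d e : aff) : hterm :=
  SignT (d + e)
  * (G (a + k) * G (b + k) * G (c + k))
  / (G (d + k) * G (e + k) * G (a + b + c - d - e + #2 + k))
  * (G (a + b - d - e + #2) * G (a + c - d - e + #2) * G (b + c - d - e + #2))
  / (G (a - d + #1) * G (a - e + #1) * G (b - d + #1) * G (b - e + #1)
     * G (c - d + #1) * G (c - e + #1)).

End HyperTerms.

(* Main.v *)
Require Import Defs.
From HB Require Import structures.
From mathcomp Require Import all_boot all_order all_algebra.
From mathcomp Require Import fraction complex reals.
From mathcomp Require Import ring zify.
Set Implicit Arguments. Unset Strict Implicit. Unset Printing Implicit Defensive.
Import Order.TTheory GRing.Theory Num.Theory.
Local Open Scope ring_scope.

(* With [f = a+b+c-d-e+2] and [k] absorbed into [x = (a,b,c)] and [y = (d,e,f)],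
   the reflection formula turns [F0] into the symmetric term
   [T = prod_i Gamma(x_i) / prod_j Gamma(y_j) / prod_ij Gamma(x_i - y_j + 1)]
   with [y_1 + y_2 + y_3 = x_1 + x_2 + x_3 + 2]. A step in [n] shifts [(x, y)] by
   an integer vector [(u, v)] with [u_1 + u_2 + u_3 = v_1 + v_2 + v_3]. The shifts
   for which [T(shifted) - T] is a [k]-difference form a group, and explicit
   certificates exist for the diagonal shift, for a simultaneous shift of one
   [x_i] and one [y_j], and for opposite shifts of two [x_i] or of two [y_j].
   Their denominators involve some of the [x_i - y_j], which may vanish at special
   parameters when [u_i = v_j]. Any [(u, v)] is however a combination of such
   shifts that keep [x_i - y_j] fixed whenever [u_i = v_j]. *)

(** * Fraction fields: extension of an injective ring morphism *)

Section FractionMap.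
Variables (R S : idomainType) (f : {rmorphism R -> S}).
Hypothesis f_inj : injective f.
Local Notation "p %:F" := (@FracField.tofrac _ p).

Lemma frac_quotient (T : idomainType) (z : {fraction T}) :
  z = (frac (repr z)).1%:F / (frac (repr z)).2%:F.
Proof.
set r := repr z.
apply: (canRL (mulfK _)); first by rewrite tofrac_eq0 denom_ratioP.
have -> : z = \pi_({fraction T})%qT r by rewrite /r reprK.
unlock FracField.tofrac; rewrite -[LHS]FracField.pi_mul.
apply/eqmodP; rewrite /= FracField.equivfE /FracField.mulf.
by rewrite !numden_Ratio ?mulf_neq0 ?oner_neq0 ?denom_ratioP ?mul1r ?mulr1 // mulrC.
Qed.

Definition frac_map (z : {fraction R}) : {fraction S} :=
  (f (frac (repr z)).1)%:F / (f (frac (repr z)).2)%:F.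

(** Independence of the chosen representative: cross-multiplication turns equality of fractions into
    an identity in [R], to which [f] applies. Injectivity of [f] keeps the image denominators
    nonzero. *)
Lemma frac_map_quotient p q : q != 0 -> frac_map (p%:F / q%:F) = (f p)%:F / (f q)%:F.
Proof.
have fF0 t : t != 0 -> (f t)%:F != 0 by rewrite tofrac_eq0 (raddf_eq0 _ f_inj).
move=> q0; rewrite /frac_map; set z := p%:F / q%:F; have := frac_quotient z.
have := denom_ratioP (repr z); move: (frac _).1 (frac _).2 => n d d0.
move/eqP; rewrite {1}/z eqr_div ?tofrac_eq0 // -!tofracM tofrac_eq => /eqP e.
by apply/eqP; rewrite eqr_div ?fF0 // -!tofracM -!rmorphM e.
Qed.

Lemma frac_ind (P : {fraction R} -> Prop) :
  (forall p q, q != 0 -> P (p%:F / q%:F)) -> forall z, P z.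
Proof. by move=> PF z; rewrite (frac_quotient z); exact/PF/denom_ratioP. Qed.

Lemma frac_map_tofrac p : frac_map p%:F = (f p)%:F.
Proof.
by rewrite -[p%:F]divr1 -tofrac1 frac_map_quotient ?oner_neq0 // rmorph1 tofrac1 divr1.
Qed.

Fact frac_map_zmod_morphism : zmod_morphism frac_map.
Proof.
have fF0 t : t != 0 -> (f t)%:F != 0 by rewrite tofrac_eq0 (raddf_eq0 _ f_inj).
elim/frac_ind => p q q0; elim/frac_ind => p' q' q0'.
rewrite -mulNr -tofracN addf_div ?tofrac_eq0 // -!tofracM -tofracD.
rewrite !frac_map_quotient ?mulf_neq0 // rmorphD !rmorphM rmorphN !(tofracD, tofracM).
by rewrite -addf_div ?fF0 // tofracN mulNr.
Qed.

Fact frac_map_monoid_morphism : monoid_morphism frac_map.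
Proof.
split; first by rewrite -tofrac1 frac_map_tofrac rmorph1.
elim/frac_ind => p q q0; elim/frac_ind => p' q' q0'.
by rewrite mulf_div -!tofracM !frac_map_quotient ?mulf_neq0 // !rmorphM mulf_div.
Qed.

Definition frac_rmorphism : {rmorphism {fraction R} -> {fraction S}} :=
  HB.pack frac_map
    (GRing.isZmodMorphism.Build _ _ frac_map frac_map_zmod_morphism)
    (GRing.isMonoidMorphism.Build _ _ frac_map frac_map_monoid_morphism).

End FractionMap.

(** * Rising factorials with integer index *)

Section Poch.
Variable K : fieldType.

(** Guarantees that no factor of [rising z m] vanishes, whatever the sign of [m]. *)
Definition nonint (z : K) := forall m : int, z + m%:~R != 0.

Definition rising (z : K) (m : int) : K :=
  match m with
  | Posz j => \prod_(i < j) (z + i%:R)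
  | Negz j => (\prod_(i < j.+1) (z - i.+1%:R))^-1
  end.

Lemma nonintD z (m : int) : nonint z -> nonint (z + m%:~R).
Proof. by move=> zZ n; rewrite -addrA -intrD. Qed.

Lemma rising0 z : rising z 0 = 1.
Proof. by rewrite /= big_ord0. Qed.

Lemma rising1 z : rising z 1 = z.
Proof. by rewrite /= big_ord1 addr0. Qed.

Lemma risingN1 z : rising z (-1) = (z - 1)^-1.
Proof. by rewrite /= big_ord1. Qed.

Lemma risingS z m : nonint z -> rising z (m + 1) = rising z m * (z + m%:~R).
Proof.
case: m => [j|[|j]] zZ.
- by rewrite -[Posz j + 1]/(Posz (j + 1)) addn1 /= big_ord_recr.
- by rewrite rising0 risingN1 mulVf ?(zZ (-1)).
- have -> : Negz j.+1 + 1 = Negz j by rewrite !NegzE; lia.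
  rewrite /= [X in _ = X^-1 * _]big_ord_recr /= invfM -mulrA NegzE mulrNz.
  by rewrite mulVf ?mulr1 // (zZ (- (j.+2%:Z))).
Qed.

Lemma risingD z m n : nonint z ->
  rising z (m + n) = rising z m * rising (z + m%:~R) n.
Proof.
move=> zZ; elim/int_rect: n => [|n IH|n IH]; first by rewrite rising0 addr0 mulr1.
  have -> : (n.+1 : int) = n%:Z + 1 by lia.
  by rewrite addrA !risingS ?IH -?mulrA -?addrA -?intrD //; exact: nonintD.
have zE : z + (m - n.+1%:Z)%:~R != 0 by apply: zZ.
  apply: (mulIf zE); rewrite -risingS // -mulrA.
  have -> : z + (m - n.+1%:Z)%:~R = z + m%:~R + (- n.+1%:Z)%:~R
    by rewrite -addrA -intrD.
  rewrite -risingS; last exact: nonintD.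
  have e : - n.+1%:Z + 1 = - n%:Z by lia.
  by rewrite -addrA e IH.
Qed.

(** Both sides times [z] compute [rising z (m + 1)], with either the first or the last factor split
    off. *)
Lemma rising_shift z m : nonint z -> rising (z + 1) m = rising z m * (z + m%:~R) / z.
Proof.
move=> zZ; have z0 : z != 0 by have := zZ 0; rewrite addr0.
apply: (canRL (mulfK z0)); rewrite -risingS // [m + 1]addrC.
by rewrite risingD // rising1 mulrC.
Qed.

(** Discrete form of the reflection formula for Gamma. The factors of the two products agree one by
    one up to sign, so the identity persists where some of them vanish. *)
Lemma rising_refl z m : rising (1 - z) (- m) = (-1) ^ m / rising z m.
Proof.
have prodN n (g h : 'I_n -> K) : (forall i, g i = - h i) ->
    \prod_i g i = (-1) ^+ n * \prod_i h i.
  by move=> gh; rewrite (eq_bigr _ (fun i _ => gh i)) prodrN card_ord.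
case: m => [[|j]|j].
- by rewrite oppr0 !rising0 divr1.
- rewrite -NegzE /= (prodN _ _ (fun i : 'I_j.+1 => z + i%:R)) => [|i].
    by rewrite invfM -exprVn invrN1.
  by rewrite -natr1; ring.
- rewrite NegzE opprK /= invrK (prodN _ _ (fun i : 'I_j.+1 => z - i.+1%:R)) => [|i].
    by rewrite -exprnN -exprVn invrN1.
  by rewrite -natr1; ring.
Qed.
End Poch.
Arguments rising : simpl never.

(** * Generation of balanced integer shifts by elementary moves *)

Section Generation.

Definition distinct3 (i j k : 'I_3) := [&& i != j, i != k & j != k].

Lemma distinct3_swap i j k : distinct3 i j k -> distinct3 i k j.
Proof. by case/and3P=> ij ik jk; apply/and3P; rewrite eq_sym in jk. Qed.

Lemma distinct3_ex2 i j : i != j -> exists k, distinct3 i j k.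
Proof.
(* Addition in ['I_3] is modulo 3, and 0 + 1 + 2 = 0 there. *)
move=> ij; exists (- (i + j)); move: ij; rewrite /distinct3.
by move: i j => [[|[|[|i]]] Hi] [[|[|[|j]]] Hj].
Qed.

Lemma distinct3_ex i : exists j k, distinct3 i j k.
Proof.
exists (i + 1), (i + 1 + 1); rewrite /distinct3.
by move: i => [[|[|[|i]]] Hi].
Qed.

Lemma distinct3_ind (P : 'I_3 -> Prop) i j k :
  distinct3 i j k -> P i -> P j -> P k -> forall z, P z.
Proof.
move=> D Pi Pj Pk z; have : [|| z == i, z == j | z == k].
  move: D; rewrite /distinct3.
  by move: i j k z {Pi Pj Pk} =>
    [[|[|[|i]]] ?] [[|[|[|j]]] ?] [[|[|[|k]]] ?] [[|[|[|z]]] ?].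
by case/or3P=> /eqP ->.
Qed.

Lemma distinct3_big (T : Type) (idx : T) (op : Monoid.com_law idx) (F : 'I_3 -> T) i j k :
  distinct3 i j k -> \big[op/idx]_z F z = op (F i) (op (F j) (F k)).
Proof.
move=> D; have /and3P[ij ik jk] := D.
have ki : (k != i) && (k != j) by rewrite ![k == _]eq_sym ik jk.
rewrite (bigD1 i) // (bigD1 j) 1?eq_sym //= (bigD1 k) //=.
rewrite big1 ?Monoid.mulm1 //.
by apply: (distinct3_ind D); rewrite eqxx ?andbF.
Qed.

Lemma row3P (T : Type) i j k (a b : 'rV[T]_3) : distinct3 i j k ->
  a 0 i = b 0 i -> a 0 j = b 0 j -> a 0 k = b 0 k -> a = b.
Proof. by move=> D ei ej ek; apply/rowP; exact: (distinct3_ind D). Qed.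

(* None of the generating moves changes a difference [x i - y j] with
   [u i = v j]: those differences may be zero, or become zero under a shift. *)
Record closed_moves (u v : 'I_3 -> int) (H : 'rV[int]_3 -> 'rV[int]_3 -> Prop)
  : Prop := ClosedMoves {
  movesD : forall a b a' b', H a b -> H a' b' -> H (a + a') (b + b');
  movesZ : forall t a b, H a b -> H (t *: a) (t *: b);
  moves_diag : H (const_mx 1) (const_mx 1);
  moves_pair : forall i j, (forall j', j' != j -> u i <> v j') ->
    (forall i', i' != i -> u i' <> v j) -> H (delta_mx 0 i) (delta_mx 0 j);
  moves_left : forall i i', i != i' -> (forall j, u i <> v j) ->
    (forall j, u i' <> v j) -> H (delta_mx 0 i - delta_mx 0 i') 0;
  moves_right : forall j j', j != j' -> (forall i, u i <> v j) ->
    (forall i, u i <> v j') -> H 0 (delta_mx 0 j - delta_mx 0 j') }.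

(** Exchanging the roles of [u] and [v] halves the case analysis below. *)
Lemma closed_moves_sym u v H :
  closed_moves u v H -> closed_moves v u (fun a b => H b a).
Proof.
case=> D Z diag pair left right; split=> //.
- by move=> a b a' b'; apply: D.
- by move=> t a b; apply: Z.
- by move=> i j ui uj; apply: pair => [j' /uj|i' /ui]; apply: nesym.
- by move=> i i' ii' ui ui'; apply: right => // j; apply: nesym.
- by move=> j j' jj' uj uj'; apply: left => // i; apply: nesym.
Qed.

Lemma moves_delta u v H i i' i'' j j' j'' : closed_moves u v H ->
  distinct3 i i' i'' -> distinct3 j j' j'' ->
  u i <> v j' -> u i <> v j'' -> u i' <> v j -> u i'' <> v j ->
  H (delta_mx 0 i) (delta_mx 0 j).
Proof.
move=> HH Di Dj n1 n2 n3 n4; apply: (moves_pair HH).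
  by apply: (distinct3_ind Dj) => //; rewrite eqxx.
by apply: (distinct3_ind Di) => //; rewrite eqxx.
Qed.

(* [lia] is slow here unless the hypotheses about ordinals are cleared *)
Ltac int_lia :=
  repeat match goal with
  | H : ?T |- _ => lazymatch T with
    | _ = false => clear H
    | _ = _ => fail
    | _ <> _ => fail
    | _ \/ _ => fail
    | _ => clear H
    end
  end; lia.

(** Subtracting [v j] times the diagonal leaves only the entry [i''] on the left and the entries
    [j'], [j''] on the right. The pairs [(i'', j')] and [(i'', j'')] supply these, except when
    [u i'' = v j]: then the two right entries are opposite and a right move suffices. *)
Lemma balanced_moves_three u v H i i' i'' j j' j'' : closed_moves u v H ->
  distinct3 i i' i'' -> distinct3 j j' j'' ->
  u i = v j -> u i' = v j -> u i' + u i'' = v j' + v j'' ->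
  H (\row_z u z) (\row_z v z).
Proof.
move=> HH Di Dj uij ui'j bal.
have /and3P[/negPf i1 /negPf i2 /negPf i3] := Di.
have /and3P[/negPf j1 /negPf j2 /negPf j3] := Dj.
have iE := (i1, i2, i3, eq_sym i' i, eq_sym i'' i, eq_sym i'' i').
have jE := (j1, j2, j3, eq_sym j' j, eq_sym j'' j, eq_sym j'' j').
have diag := movesZ HH (v j) (moves_diag HH).
have gen a b : H a b -> (forall z, a 0 z = u z - v j) -> (forall z, b 0 z = v z - v j) ->
    H (\row_z u z) (\row_z v z).
  move=> Hab aE bE; have := movesD HH diag Hab.
  by congr H; apply/rowP => z; rewrite !mxE ?aE ?bE mulr1 addrC subrK.
have comb a b : H a b ->
    [/\ a 0 i = 0, a 0 i' = 0 & a 0 i'' = u i'' - v j] ->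
    [/\ b 0 j = 0, b 0 j' = v j' - v j & b 0 j'' = v j'' - v j] ->
    H (\row_z u z) (\row_z v z).
  move=> Hab [a1 a2 a3] [b1 b2 b3]; apply: (gen _ _ Hab).
    by apply: (distinct3_ind Di); rewrite ?a1 ?a2 ?a3; int_lia.
  by apply: (distinct3_ind Dj); rewrite ?b1 ?b2 ?b3; int_lia.
have pair' : v j' <> v j -> u i'' <> v j -> u i'' <> v j'' -> H (delta_mx 0 i'') (delta_mx 0 j').
  move=> *; apply: (moves_delta (i' := i) (i'' := i') (j' := j) (j'' := j'') HH);
  by rewrite /distinct3 ?iE ?jE //; int_lia.
have pair'' : v j'' <> v j -> u i'' <> v j -> u i'' <> v j' -> H (delta_mx 0 i'') (delta_mx 0 j'').
  move=> *; apply: (moves_delta (i' := i) (i'' := i') (j' := j) (j'' := j') HH);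
  by rewrite /distinct3 ?iE ?jE //; int_lia.
have [vj'|/eqP vj'] := eqVneq (v j') (v j);
have [vj''|/eqP vj''] := eqVneq (v j'') (v j).
- apply: (comb _ _ (movesZ HH 0 (moves_diag HH)));
  by split; rewrite !mxE; int_lia.
- have P : H (delta_mx 0 i'') (delta_mx 0 j'') by apply: pair''; int_lia.
  by apply: (comb _ _ (movesZ HH (v j'' - v j) P)); split;
    rewrite !mxE /= ?eqxx ?iE ?jE; int_lia.
- have P : H (delta_mx 0 i'') (delta_mx 0 j') by apply: pair'; int_lia.
  by apply: (comb _ _ (movesZ HH (v j' - v j) P)); split;
    rewrite !mxE /= ?eqxx ?iE ?jE; int_lia.
have [ui''|/eqP ui''] := eqVneq (u i'') (v j).
  have P : H 0 (delta_mx 0 j' - delta_mx 0 j'').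
    apply: (moves_right HH); first by rewrite j3.
      by apply: (distinct3_ind Di); int_lia.
    by apply: (distinct3_ind Di); int_lia.
  by apply: (comb _ _ (movesZ HH (v j' - v j) P)); split;
    rewrite !mxE /= ?eqxx ?iE ?jE; int_lia.
(* By balance [u i'' - v j'' = v j' - v j] and [u i'' - v j' = v j'' - v j], both nonzero here, so
   both pairs are available. *)
have P1 : H (delta_mx 0 i'') (delta_mx 0 j') by apply: pair'; int_lia.
have P2 : H (delta_mx 0 i'') (delta_mx 0 j'') by apply: pair''; int_lia.
apply: (comb _ _ (movesD HH (movesZ HH (v j' - v j) P1) (movesZ HH (v j'' - v j) P2)));
by split; rewrite !mxE /= ?eqxx ?iE ?jE; int_lia.
Qed.

(** The cases follow the coincidences [u i = v j]: with none, all nine pairs are available; a value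
    shared by three entries is handled by [balanced_moves_three] or its mirror image; otherwise the
    coincidence is isolated and the remaining 2 by 2 block is examined. *)
Lemma balanced_moves u v H : closed_moves u v H ->
  \sum_i u i = \sum_j v j -> H (\row_z u z) (\row_z v z).
Proof.
move=> HH bal.
have [/existsP[i /existsP[j /eqP uv]]|none] :=
    boolP [exists i, exists j, u i == v j]; last first.
  have P i j : H (delta_mx 0 i) (delta_mx 0 j).
    have uv i' j' : u i' <> v j'.
      by move=> e; case/existsP: none; exists i'; apply/existsP; exists j'; exact/eqP.
    by apply: (moves_pair HH).
  have [i' [i'' Di]] := distinct3_ex ord0.
  have /and3P[/negPf i1 /negPf i2 /negPf i3] := Di.
  have iE := (i1, i2, i3, eq_sym i' ord0, eq_sym i'' ord0, eq_sym i'' i').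
  move: bal; rewrite !(distinct3_big _ _ Di) /= => bal.
  pose s k l c := movesZ HH c (P k l).
  (* The coefficients form a staircase matrix with row sums [u] and column sums [v], as in the
     northwest corner rule; negative entries are allowed. *)
  have := movesD HH (movesD HH (s ord0 ord0 (u ord0)) (s i' ord0 (v ord0 - u ord0)))
    (movesD HH (s i' i' (u ord0 + u i' - v ord0))
      (movesD HH (s i'' i' (v ord0 + v i' - u ord0 - u i')) (s i'' i'' (v i'')))).
  congr H; apply: (row3P Di); rewrite !mxE /= ?eqxx ?iE; int_lia.
have [i' [i'' Di]] := distinct3_ex i; have [j' [j'' Dj]] := distinct3_ex j.
move: bal; rewrite (distinct3_big _ _ Di) (distinct3_big _ _ Dj) /= => bal.
have three := balanced_moves_three HH.
have three' := balanced_moves_three (closed_moves_sym HH).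
have Di' := distinct3_swap Di; have Dj' := distinct3_swap Dj.
have [ui'|/eqP ui'] := eqVneq (u i') (v j).
  by apply: (three _ _ _ _ _ _ Di Dj); int_lia.
have [ui''|/eqP ui''] := eqVneq (u i'') (v j).
  by apply: (three _ _ _ _ _ _ Di' Dj); int_lia.
have [vj'|/eqP vj'] := eqVneq (v j') (u i).
  by apply: (three' _ _ _ _ _ _ Dj Di); int_lia.
have [vj''|/eqP vj''] := eqVneq (v j'') (u i).
  by apply: (three' _ _ _ _ _ _ Dj' Di); int_lia.
have /and3P[/negPf i1 /negPf i2 /negPf i3] := Di.
have /and3P[/negPf j1 /negPf j2 /negPf j3] := Dj.
have iE := (i1, i2, i3, eq_sym i' i, eq_sym i'' i, eq_sym i'' i').
have jE := (j1, j2, j3, eq_sym j' j, eq_sym j'' j, eq_sym j'' j').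
have comb a b : H a b ->
    [/\ a 0 i = u i, a 0 i' = u i' & a 0 i'' = u i''] ->
    [/\ b 0 j = v j, b 0 j' = v j' & b 0 j'' = v j''] ->
    H (\row_z u z) (\row_z v z).
  move=> Hab [a1 a2 a3] [b1 b2 b3]; move: Hab.
  by congr H; [apply: (row3P Di) | apply: (row3P Dj)]; rewrite mxE.
pose s k l c (P : H (delta_mx 0 k) (delta_mx 0 l)) := movesZ HH c P.
pose dg c := movesZ HH c (moves_diag HH).
(* From here on the value [u i = v j] occurs only at [i] and [j]. By balance, [u i'] equals one of
   [v j'], [v j''] exactly when [u i''] equals the other. *)
have [[P01 P02]|P0] : (u i' <> v j' /\ u i' <> v j'') \/ (u i' = v j' \/ u i' = v j'').
- by int_lia.
- have P1 : H (delta_mx 0 i') (delta_mx 0 j').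
    by apply: (moves_delta (i' := i) (i'' := i'') (j' := j) (j'' := j'') HH);
      rewrite /distinct3 ?iE ?jE //; int_lia.
  have P2 : H (delta_mx 0 i'') (delta_mx 0 j').
    by apply: (moves_delta (i' := i) (i'' := i') (j' := j) (j'' := j'') HH);
      rewrite /distinct3 ?iE ?jE //; int_lia.
  have P3 : H (delta_mx 0 i'') (delta_mx 0 j'').
    by apply: (moves_delta (i' := i) (i'' := i') (j' := j) (j'' := j') HH);
      rewrite /distinct3 ?iE ?jE //; int_lia.
  apply: (comb _ _ (movesD HH (movesD HH (dg (v j)) (s _ _ (u i' - v j) P1))
    (movesD HH (s _ _ (v j' - u i') P2) (s _ _ (v j'' - v j) P3))));
  by split; rewrite !mxE /= ?eqxx ?iE ?jE; int_lia.
(* If the four remaining values are all equal, the diagonal takes that value and the pair [(i, j)]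
   corrects the rest. Otherwise the two coincidences have distinct values, and each is served by its
   own pair. *)
have [[P11 P12]|P1] : (u i' = v j' /\ u i' = v j'') \/ u i'' <> u i' by int_lia.
- have P : H (delta_mx 0 i) (delta_mx 0 j).
    by apply: (moves_delta (i' := i') (i'' := i'') (j' := j') (j'' := j'') HH);
      rewrite /distinct3 ?iE ?jE //; int_lia.
  apply: (comb _ _ (movesD HH (dg (u i')) (s _ _ (v j - u i') P)));
  by split; rewrite !mxE /= ?eqxx ?iE ?jE; int_lia.
case: P0 => P0.
- have P2 : H (delta_mx 0 i') (delta_mx 0 j').
    by apply: (moves_delta (i' := i) (i'' := i'') (j' := j) (j'' := j'') HH);
      rewrite /distinct3 ?iE ?jE //; int_lia.
  have P3 : H (delta_mx 0 i'') (delta_mx 0 j'').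
    by apply: (moves_delta (i' := i) (i'' := i') (j' := j) (j'' := j') HH);
      rewrite /distinct3 ?iE ?jE //; int_lia.
  apply: (comb _ _ (movesD HH (dg (v j))
    (movesD HH (s _ _ (u i' - v j) P2) (s _ _ (u i'' - v j) P3))));
  by split; rewrite !mxE /= ?eqxx ?iE ?jE; int_lia.
- have P2 : H (delta_mx 0 i') (delta_mx 0 j'').
    by apply: (moves_delta (i' := i) (i'' := i'') (j' := j) (j'' := j') HH);
      rewrite /distinct3 ?iE ?jE //; int_lia.
  have P3 : H (delta_mx 0 i'') (delta_mx 0 j').
    by apply: (moves_delta (i' := i) (i'' := i') (j' := j) (j'' := j'') HH);
      rewrite /distinct3 ?iE ?jE //; int_lia.
  apply: (comb _ _ (movesD HH (dg (v j))
    (movesD HH (s _ _ (u i' - v j) P2) (s _ _ (u i'' - v j) P3))));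
  by split; rewrite !mxE /= ?eqxx ?iE ?jE; int_lia.
Qed.

End Generation.

(** * Telescoping in a field with a shift endomorphism *)

Section Telescoping.
Variables (K : fieldType) (sigma : {rmorphism K -> K}).
Variables u0 v0 : 'I_3 -> int.

Implicit Types (x y : 'I_3 -> K) (u v : 'rV[int]_3).

Definition shift_by x u : 'I_3 -> K := fun i => x i + (u 0 i)%:~R.

(** The [k]-ratio of the symmetric term: the differences [x i - y j] do not involve [k], so only the
    outer Gamma factors contribute. *)
Definition kquot x y : K := (\prod_i x i) / (\prod_j y j).

(* The value at the shift [(x + u, y + v)], divided by the value at [(x, y)], of
   [prod_i Gamma(x_i) / prod_j Gamma(y_j) / prod_ij Gamma(x_i - y_j + 1)].
   The summation variable [k] is absorbed into the [x_i] and the [y_j]. *)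
Definition shift_ratio x y u v : K :=
  (\prod_i rising (x i) (u 0 i)) / (\prod_j rising (y j) (v 0 j))
  / \prod_i \prod_j rising (x i - y j + 1) (u 0 i - v 0 j).

(* Nothing is required when [u0 i = v0 j]: then [x i - y j] is constant along the
   line of direction [(u0, v0)] and may be an integer. *)
Record generic x y : Prop := Generic {
  generic_x : forall i, sigma (x i) = x i + 1;
  generic_y : forall j, sigma (y j) = y j + 1;
  generic_sum : \sum_j y j = \sum_i x i + 2%:R;
  generic_diff : forall i j, u0 i <> v0 j -> nonint (x i - y j) }.

Record compatible u v : Prop := Compatible {
  compatible_sum : \sum_i u 0 i = \sum_j v 0 j;
  compatible_diff : forall i j, u0 i = v0 j -> u 0 i = v 0 j }.

(* [f T] is the [k]-difference of [R T], when [sigma] is the shift of [k] and [q]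
   is the [k]-ratio of [T]. *)
Definition telescopes (q f : K) := exists R, f = sigma R * q - R.

(** All generic base points are quantified over, so that a certificate can be reused at a shifted
    base point. *)
Definition summable u v := compatible u v /\
  forall x y, generic x y -> telescopes (kquot x y) (shift_ratio x y u v - 1).

(** If [z + m] were 0, applying [sigma] would give [z + m + 1 = 0], hence [1 = 0]. *)
Lemma nonint_sigma z : sigma z = z + 1 -> nonint z.
Proof.
move=> sz m; apply/negP => /eqP e0; have /eqP := congr1 sigma e0.
by rewrite rmorphD rmorph_int rmorph0 sz addrAC e0 add0r oner_eq0.
Qed.

Lemma nonint_neq0 (z : K) : nonint z -> z != 0.
Proof. by move/(_ 0); rewrite addr0. Qed.

Lemma compatibleD u v u' v' :
  compatible u v -> compatible u' v' -> compatible (u + u') (v + v').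
Proof.
case=> s d [s' d']; split=> [|i j ij].
  by under eq_bigr do rewrite mxE; under [RHS]eq_bigr do rewrite mxE;
    rewrite !big_split /= s s'.
by rewrite !mxE (d _ _ ij) (d' _ _ ij).
Qed.

Lemma compatibleZ t u v : compatible u v -> compatible (t *: u) (t *: v).
Proof.
case=> s d; split=> [|i j ij]; last by rewrite !mxE (d _ _ ij).
by under eq_bigr do rewrite mxE; under [RHS]eq_bigr do rewrite mxE;
  rewrite -!mulr_sumr s.
Qed.

Lemma generic_shift x y u v :
  generic x y -> compatible u v -> generic (shift_by x u) (shift_by y v).
Proof.
case=> sx sy s d [s' d']; split.
- by move=> i; rewrite /shift_by rmorphD rmorph_int sx addrAC.
- by move=> i; rewrite /shift_by rmorphD rmorph_int sy addrAC.
- rewrite !big_split /= s -!rmorph_sum s' /=; ring.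
- move=> i j ij m; have := d i j ij (u 0 i - v 0 j + m).
  by rewrite /shift_by !(intrD, mulrNz); congr (_ != 0); ring.
Qed.

Lemma shift_ratioD x y u v u' v' :
  generic x y -> compatible u v -> compatible u' v' ->
  shift_ratio x y (u + u') (v + v') =
  shift_ratio x y u v * shift_ratio (shift_by x u) (shift_by y v) u' v'.
Proof.
move=> [sx sy _ d] [_ cd] [_ cd'].
rewrite /shift_ratio.
have -> : \prod_i rising (x i) ((u + u') 0 i) =
    \prod_i rising (x i) (u 0 i) * \prod_i rising (shift_by x u i) (u' 0 i).
  rewrite -big_split; apply: eq_bigr => i _.
  by rewrite mxE risingD //; exact: nonint_sigma.
have -> : \prod_i rising (y i) ((v + v') 0 i) =
    \prod_i rising (y i) (v 0 i) * \prod_i rising (shift_by y v i) (v' 0 i).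
  rewrite -big_split; apply: eq_bigr => i _.
  by rewrite mxE risingD //; exact: nonint_sigma.
have -> : \prod_i \prod_j rising (x i - y j + 1) ((u + u') 0 i - (v + v') 0 j) =
    \prod_i \prod_j rising (x i - y j + 1) (u 0 i - v 0 j) *
    \prod_i \prod_j rising (shift_by x u i - shift_by y v j + 1) (u' 0 i - v' 0 j).
  rewrite -big_split; apply: eq_bigr => i _.
  rewrite -big_split; apply: eq_bigr => j _ /=.
  (* When [u0 i = v0 j] the difference may be an integer, but compatibility makes every index 0 and
     the factors are 1. *)
  rewrite !mxE; have [ij|/eqP ij] := eqVneq (u0 i) (v0 j).
    by rewrite (cd _ _ ij) (cd' _ _ ij) !subrr !rising0 mulr1.
  have -> : u 0 i + u' 0 i - (v 0 j + v' 0 j) = (u 0 i - v 0 j) + (u' 0 i - v' 0 j).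
    by ring.
  rewrite risingD; last exact: (nonintD 1 (d _ _ ij)).
  by congr (_ * rising _ _); rewrite /shift_by intrD mulrNz; ring.
by rewrite !invfM; ring.
Qed.

Lemma shift_ratio0 x y : shift_ratio x y 0 0 = 1.
Proof.
rewrite /shift_ratio !big1 ?invr1 ?mulr1 // => i _; rewrite ?mxE ?rising0 //.
by rewrite big1 // => j _; rewrite !mxE subrr rising0.
Qed.

Lemma sigma_rising z m : sigma (rising z m) = rising (sigma z) m.
Proof.
case: m => n; rewrite /rising ?fmorphV rmorph_prod; [|congr (_^-1)];
  by apply: eq_bigr => i _; rewrite ?rmorphB ?rmorphD rmorph_nat.
Qed.

(** The shift by [(u, v)] commutes with the shift of [k]: both sides are the term after both shifts,
    divided by the original term. *)
Lemma sigma_shift_ratio x y u v : generic x y ->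
  sigma (shift_ratio x y u v) * kquot x y =
  shift_ratio x y u v * kquot (shift_by x u) (shift_by y v).
Proof.
move=> [sx sy _ _]; rewrite /shift_ratio /kquot.
have prodE z (w : 'rV[int]_3) : (forall i, sigma (z i) = z i + 1) ->
    sigma (\prod_i rising (z i) (w 0 i)) * \prod_i z i =
    \prod_i rising (z i) (w 0 i) * \prod_i shift_by z w i.
  move=> sz; rewrite rmorph_prod -!big_split; apply: eq_bigr => i _ /=.
  have zZ := nonint_sigma (sz i).
  by rewrite sigma_rising sz rising_shift // mulfVK // nonint_neq0.
rewrite !rmorphM !fmorphV.
have -> : sigma (\prod_i \prod_j rising (x i - y j + 1) (u 0 i - v 0 j)) =
    \prod_i \prod_j rising (x i - y j + 1) (u 0 i - v 0 j).
  rewrite rmorph_prod; apply: eq_bigr => i _; rewrite rmorph_prod.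
  apply: eq_bigr => j _; rewrite sigma_rising rmorphD rmorphB rmorph1 sx sy.
  by congr (rising _ _); ring.
have /(congr1 GRing.inv) := prodE y v sy; have := prodE x u sx.
rewrite !invfM => ex ey.
transitivity ((sigma (\prod_i rising (x i) (u 0 i)) * \prod_i x i)
  * ((sigma (\prod_i rising (y i) (v 0 i)))^-1 * (\prod_i y i)^-1)
  / (\prod_i \prod_j rising (x i - y j + 1) (u 0 i - v 0 j))); first by ring.
by rewrite ex ey; ring.
Qed.

Lemma telescopesD q f g : telescopes q f -> telescopes q g -> telescopes q (f + g).
Proof. by move=> [R ->] [S ->]; exists (R + S); rewrite rmorphD; ring. Qed.

Lemma telescopes_shift x y u v f : generic x y ->
  telescopes (kquot (shift_by x u) (shift_by y v)) f ->
  telescopes (kquot x y) (shift_ratio x y u v * f).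
Proof.
move=> xy [R ->]; exists (shift_ratio x y u v * R).
by rewrite rmorphM [X in _ = X - _]mulrAC sigma_shift_ratio //; ring.
Qed.

Lemma telescopesN q f : telescopes q f -> telescopes q (- f).
Proof. by move=> [R ->]; exists (- R); rewrite rmorphN; ring. Qed.

(** The difference for the composite shift splits as the second difference, taken at the shifted
    base point, plus the first one. *)
Lemma summableD u v u' v' :
  summable u v -> summable u' v' -> summable (u + u') (v + v').
Proof.
move=> [c s] [c' s']; split; first exact: compatibleD.
move=> x y xy; rewrite shift_ratioD //.
have := telescopes_shift xy (s' _ _ (generic_shift xy c)).
move/telescopesD/(_ (s _ _ xy)); congr telescopes; ring.
Qed.

Lemma summable0 : summable 0 0.
Proof.
split; first by split=> [|i j _]; rewrite ?mxE //; apply: eq_bigr => i _; rewrite !mxE.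
by move=> x y _; exists 0; rewrite shift_ratio0 rmorph0; ring.
Qed.

Lemma summableN u v : summable u v -> summable (- u) (- v).
Proof.
move=> [c s]; have c' : compatible (- u) (- v).
  by rewrite -!scaleN1r; exact: compatibleZ.
split=> // x y xy.
have := telescopes_shift xy (s _ _ (generic_shift xy c')).
move/telescopesN; congr telescopes.
rewrite mulrBr -shift_ratioD // !addNr shift_ratio0; ring.
Qed.

Lemma summableZ t u v : summable u v -> summable (t *: u) (t *: v).
Proof.
move=> uv; elim/int_rect: t => [|n IH|n IH]; rewrite ?scale0r.
- exact: summable0.
- by rewrite intS !scalerDl !scale1r; apply: summableD.
- by rewrite intS opprD !scalerDl !scaleN1r; apply: summableD => //; apply: summableN.
Qed.

(** * Explicit certificates for the elementary moves *)

Lemma summable_diag : summable (const_mx 1) (const_mx 1).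
Proof.
split; first by split=> [|i j _]; rewrite ?mxE //; apply: eq_bigr => i _; rewrite !mxE.
(* The diagonal shift is the shift of [k] itself, so the term is its own mate. *)
move=> x y xy; exists 1; rewrite rmorph1 mul1r; congr (_ - _).
rewrite /shift_ratio [X in _ / X]big1 => [|i _]; last first.
  by rewrite big1 // => j _; rewrite !mxE subrr rising0.
by rewrite divr1; congr (_ / _); apply: eq_bigr => i _; rewrite mxE rising1.
Qed.

Lemma generic_sum3 x y i i' i'' j j' j'' : generic x y ->
  distinct3 i i' i'' -> distinct3 j j' j'' ->
  y j'' = x i + x i' + x i'' + 2%:R - y j - y j'.
Proof.
case=> _ _ s _ Di Dj; move: s.
rewrite (distinct3_big _ x Di) (distinct3_big _ y Dj) /= => s.
have -> : y j'' = (y j + (y j' + y j'')) - y j - y j' by ring.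
by rewrite s; ring.
Qed.

Lemma kquot3 x y i i' i'' j j' j'' : distinct3 i i' i'' -> distinct3 j j' j'' ->
  kquot x y = (x i * (x i' * x i'')) / (y j * (y j' * y j'')).
Proof.
by move=> Di Dj; rewrite /kquot (distinct3_big _ x Di) (distinct3_big _ y Dj).
Qed.

Lemma shift_ratio3 x y u v i i' i'' j j' j'' :
  distinct3 i i' i'' -> distinct3 j j' j'' ->
  let X k := rising (x k) (u 0 k) in let Y l := rising (y l) (v 0 l) in
  let Z k l := rising (x k - y l + 1) (u 0 k - v 0 l) in
  shift_ratio x y u v = (X i * (X i' * X i'')) / (Y j * (Y j' * Y j''))
    / ((Z i j * (Z i j' * Z i j'')) * ((Z i' j * (Z i' j' * Z i' j''))
       * (Z i'' j * (Z i'' j' * Z i'' j'')))).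
Proof.
move=> Di Dj X Y Z; rewrite /shift_ratio (distinct3_big _ X Di) (distinct3_big _ Y Dj).
by rewrite (distinct3_big _ _ Di) !(distinct3_big _ (Z _) Dj).
Qed.

Lemma sum_delta_mx n (i : 'I_n) : \sum_z (delta_mx 0 i : 'rV[int]_n) 0 z = 1.
Proof.
rewrite (bigD1 i) //= big1 ?addr0 ?mxE ?eqxx // => z /negPf zi.
by rewrite mxE zi andbF.
Qed.

Lemma summable_pair i j : (forall j', j' != j -> u0 i <> v0 j') ->
  (forall i', i' != i -> u0 i' <> v0 j) -> summable (delta_mx 0 i) (delta_mx 0 j).
Proof.
move=> ui uj; split.
  split; first by rewrite !sum_delta_mx.
  move=> z t zt; rewrite !mxE /=.
  have [ez|/eqP zi] := eqVneq z i; have [et|/eqP tj] := eqVneq t j => //.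
    by case: (ui t); [exact/eqP | rewrite -ez].
  by case: (uj z); [exact/eqP | rewrite -et].
move=> x y xy; have [sx sy _ d] := xy.
have [i' [i'' Di]] := distinct3_ex i; have [j' [j'' Dj]] := distinct3_ex j.
have /and3P[/negPf i1 /negPf i2 /negPf i3] := Di.
have /and3P[/negPf j1 /negPf j2 /negPf j3] := Dj.
have iE := (i1, i2, i3, eq_sym i' i, eq_sym i'' i, eq_sym i'' i').
have jE := (j1, j2, j3, eq_sym j' j, eq_sym j'' j, eq_sym j'' j').
(* After multiplication by [y j], both sides of the certificate equation are
   affine in [k] because [generic_sum] cancels the quadratic terms, and they
   agree where [x i = 0] and where [y j = 0]. *)
exists ((y j' - 1) * (y j'' - 1) / ((x i - y j' + 1) * (x i - y j'' + 1))).
rewrite (kquot3 _ _ Di Dj) (shift_ratio3 _ _ _ _ Di Dj).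
rewrite !mxE /= !eqxx !iE !jE /= !(subrr, subr0, sub0r) !(rising0, rising1, risingN1).
rewrite !(rmorphM, fmorphV, rmorphB, rmorphD, rmorph1) /= !sx !sy.
have nz z : sigma z = z + 1 -> z != 0 by move/nonint_sigma/nonint_neq0.
have y1 := nz _ (sy j); have y2 := nz _ (sy j'); have y3 := nz _ (sy j'').
have d1 : x i - y j' + 1 != 0 by apply: (d i j' (ui j' _) 1); rewrite !jE.
have d2 : x i - y j'' + 1 != 0 by apply: (d i j'' (ui j'' _) 1); rewrite !jE.
have d3 : x i' - y j != 0 by apply/nonint_neq0/d/uj; rewrite !iE.
have d4 : x i'' - y j != 0 by apply/nonint_neq0/d/uj; rewrite !iE.
move: y1 y2 y3 d1 d2 d3 d4; rewrite (generic_sum3 xy Di Dj).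
move: (x i) (x i') (x i'') (y j) (y j') => x1 x2 x3 y1 y2 *.
by field; rewrite !addrK; do !(apply/andP; split).
Qed.

Lemma summable_left i i' : i != i' -> (forall j, u0 i <> v0 j) ->
  (forall j, u0 i' <> v0 j) -> summable (delta_mx 0 i - delta_mx 0 i') 0.
Proof.
move=> ii' ui ui'; split.
  split.
    under eq_bigr do rewrite !mxE; under [RHS]eq_bigr do rewrite mxE.
    rewrite sumrB big1_eq.
    have := sum_delta_mx i; under eq_bigr do rewrite mxE; move=> ->.
    by have := sum_delta_mx i'; under eq_bigr do rewrite mxE; move=> ->.
  move=> z t zt; rewrite !mxE /=.
  have [ez|zi] := eqVneq z i; first by case: (ui t); rewrite -ez.
  by have [ez|//] := eqVneq z i'; case: (ui' t); rewrite -ez.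
move=> x y xy; have [sx sy _ d] := xy.
have [i'' Di] := distinct3_ex2 ii'; have [j' [j'' Dj]] := distinct3_ex ord0.
set j : 'I_3 := ord0 in Dj.
have /and3P[/negPf i1 /negPf i2 /negPf i3] := Di.
have iE := (i1, i2, i3, eq_sym i' i, eq_sym i'' i, eq_sym i'' i').
(* Put [s = x i], [t = x i' - 1] and let [p(z)] be the product of the [z - (y l - 1)]. The cleared
   left side [s p(t) - t p(s)] equals [(s - t) (s t (e1 - s - t) - e3)], with [e1], [e3] the sum and
   product of the [y l - 1]; the balance gives [e1 - s - t = x i'']. *)
exists ((x i - x i' + 1) / ((x i - y j + 1) * (x i - y j' + 1) * (x i - y j'' + 1))
  * ((y j - 1) * (y j' - 1) * (y j'' - 1) / (x i' - 1))).
rewrite (kquot3 _ _ Di Dj) (shift_ratio3 _ _ _ _ Di Dj).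
rewrite !mxE /= !eqxx !iE /= !(subrr, subr0, sub0r) !(rising0, rising1, risingN1).
rewrite !(rmorphM, fmorphV, rmorphB, rmorphD, rmorph1) /= !sx !sy.
have nz z : sigma z = z + 1 -> z != 0 by move/nonint_sigma/nonint_neq0.
have y1 := nz _ (sy j); have y2 := nz _ (sy j'); have y3 := nz _ (sy j'').
have x2 := nz _ (sx i').
have x2' : x i' - 1 != 0 by exact: (nonint_sigma (sx i') (-1)).
have d1 l : x i - y l + 1 != 0 := d i l (ui l) 1.
have d2 l : x i' - y l != 0 := nonint_neq0 (d i' l (ui' l)).
move: y1 y2 y3 x2 x2' (d1 j) (d1 j') (d1 j'') (d2 j) (d2 j') (d2 j'').
rewrite (generic_sum3 xy Di Dj).
move: (x i) (x i') (x i'') (y j) (y j') => X1 X2 X3 Y1 Y2 *.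
by field; rewrite !addrK oner_eq0; do !(apply/andP; split).
Qed.

Lemma summable_right j j' : j != j' -> (forall i, u0 i <> v0 j) ->
  (forall i, u0 i <> v0 j') -> summable 0 (delta_mx 0 j - delta_mx 0 j').
Proof.
move=> jj' vj vj'; split.
  split.
    under eq_bigr do rewrite !mxE; under [RHS]eq_bigr do rewrite !mxE.
    rewrite sumrB big1_eq.
    have := sum_delta_mx j; under eq_bigr do rewrite mxE; move=> ->.
    by have := sum_delta_mx j'; under eq_bigr do rewrite mxE; move=> ->.
  move=> z t zt; rewrite !mxE /=.
  have [et|tj] := eqVneq t j; first by case: (vj z); rewrite -et.
  by have [et|//] := eqVneq t j'; case: (vj' z); rewrite -et.
move=> x y xy; have [sx sy _ d] := xy.
have [j'' Dj] := distinct3_ex2 jj'; have [i' [i'' Di]] := distinct3_ex ord0.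
set i : 'I_3 := ord0 in Di.
have /and3P[/negPf j1 /negPf j2 /negPf j3] := Dj.
have jE := (j1, j2, j3, eq_sym j' j, eq_sym j'' j, eq_sym j'' j').
(* The same factorization, with [s = y j], [t = y j' - 1] and [p(z)] the product of the [x l - z];
   here [e1], the sum of the [x l], satisfies [e1 - s - t = y j'' - 1]. *)
exists ((y j' - y j - 1) / ((x i - y j' + 1) * (x i' - y j' + 1) * (x i'' - y j' + 1))
  * ((y j' - 1) * (y j'' - 1))).
rewrite (kquot3 _ _ Di Dj) (shift_ratio3 _ _ _ _ Di Dj).
rewrite !mxE /= !eqxx !jE /= !(subrr, subr0, sub0r, opprK).
rewrite !(rising0, rising1, risingN1).
rewrite !(rmorphM, fmorphV, rmorphB, rmorphD, rmorph1) /= !sx !sy.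
have nz z : sigma z = z + 1 -> z != 0 by move/nonint_sigma/nonint_neq0.
have y1 := nz _ (sy j); have y2 := nz _ (sy j'); have y3 := nz _ (sy j'').
have y2' : y j' - 1 != 0 by exact: (nonint_sigma (sy j') (-1)).
have d1 l : x l - y j' + 1 != 0 := d l j' (vj' l) 1.
have d2 l : x l - y j != 0 := nonint_neq0 (d l j (vj l)).
move: y1 y2 y3 y2' (d1 i) (d1 i') (d1 i'') (d2 i) (d2 i') (d2 i'').
have -> : x i'' = y j + y j' + y j'' - 2%:R - x i - x i'.
  by rewrite (generic_sum3 xy Di Dj); ring.
move: (x i) (x i') (y j) (y j') (y j'') => X1 X2 Y1 Y2 Y3 *.
by field; rewrite !addrK; do !(apply/andP; split).
Qed.

Lemma summable_closed : closed_moves u0 v0 summable.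
Proof.
split; [exact: summableD|exact: summableZ|exact: summable_diag|
  exact: summable_pair|exact: summable_left|exact: summable_right].
Qed.

Lemma telescopes_shift_ratio x y : \sum_i u0 i = \sum_j v0 j -> generic x y ->
  telescopes (kquot x y) (shift_ratio x y (\row_i u0 i) (\row_j v0 j) - 1).
Proof. by move=> bal; have [_ + xy] := balanced_moves summable_closed bal; apply. Qed.

End Telescoping.

(** * Application to the seed over rational functions in [n] and [k] *)

Arguments poch : simpl never.
Section Seed.
Variable C : numFieldType.

Lemma shiftk_inj : injective (comp_poly ('X + 1) : bipoly C -> bipoly C).
Proof.
apply: (can_inj (g := comp_poly ('X - 1))) => p.
by rewrite -comp_polyA comp_polyD comp_polyX comp_polyC subrK comp_polyXr.
Qed.

Definition sigma : {rmorphism ratfun C -> ratfun C} := frac_rmorphism shiftk_inj.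

Lemma telescopes_WZ_mate (T : hterm C) :
  telescopes sigma (hrk T) (hrn T - 1) -> has_WZ_mate T.
Proof.
case=> R e; have RE := frac_quotient R; have Q0 := denom_ratioP (repr R).
exists (frac (repr R)).1, (frac (repr R)).2; split=> //.
by rewrite e /tof -RE {1}RE /= (frac_map_quotient shiftk_inj).
Qed.

Definition affF (u : aff C) : ratfun C := tof (affP u).

Lemma affPD u v : affP (aadd u v) = affP u + affP v :> bipoly C.
Proof. by rewrite /affP /= !mulrzDr !polyCD; ring. Qed.

Lemma affPB u v : affP (asub u v) = affP u - affP v :> bipoly C.
Proof. by rewrite /affP /= !mulrzBr !polyCB; ring. Qed.

Lemma affFD u v : affF (aadd u v) = affF u + affF v.
Proof. by rewrite /affF affPD; exact: rmorphD. Qed.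

Lemma affFB u v : affF (asub u v) = affF u - affF v.
Proof. by rewrite /affF affPB; exact: rmorphB. Qed.

Lemma affF_int (m : int) : affF (aconst m%:~R) = m%:~R.
Proof.
rewrite /affF /affP /= !mulr0z !addr0 /tof -[in RHS](rmorph_int (@FracField.tofrac _)).
by rewrite !rmorph_int.
Qed.

Lemma affF_neq0 u : affn u != 0 -> affF u != 0.
Proof.
move=> un; rewrite tofrac_eq0; apply/eqP => /(congr1 (fun p : bipoly C => p`_0`_1)).
rewrite /affP /varn /vark !(coefD, coefMrz, coefC, coefX) /=.
rewrite mul0rz add0r addr0 => /eqP; rewrite intr_eq0.
exact/negP.
Qed.

Lemma sigma_affF u : sigma (affF u) = affF u + (affk u)%:~R.
Proof.
rewrite /= /affF (frac_map_tofrac shiftk_inj) /affP /tof /varn /vark.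
rewrite -[_%:~R](rmorph_int (@FracField.tofrac _)) -rmorphD; congr FracField.tofrac.
rewrite !rmorphD /= !raddfMz /= !comp_polyC comp_polyX mulrzDl; ring.
Qed.

Lemma pochE u m : poch (affP u) m = rising (affF u) m.
Proof.
rewrite /poch /rising; case: m => j; [|congr (_^-1)]; apply: eq_bigr => i _;
  by rewrite /affF; move: (affP u) => p; rewrite /tof ?rmorphB ?rmorphD rmorph_nat.
Qed.

Definition row3 (T : Type) (s t u : T) (i : 'I_3) : T := nth s [:: s; t; u] i.

Lemma F0_seed : WZ_seed5 (@F0 C).
Proof.
move=> K A B C' D E k0 a b c d e; apply: telescopes_WZ_mate.
set k := Aff k0 K 1; set ea := Aff a A 0; set eb := Aff b B 0; set ec := Aff c C' 0.
set ed := Aff d D 0; set ee := Aff e E 0.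
pose ef := aadd (asub (asub (aadd (aadd ea eb) ec) ed) ee) (aconst 2%:R).
pose X := row3 (aadd ea k) (aadd eb k) (aadd ec k).
pose Y := row3 (aadd ed k) (aadd ee k) (aadd ef k).
pose u i := affn (X i); pose v j := affn (Y j).
have bal : \sum_i u i = \sum_j v j.
  by rewrite !big_ord_recr !big_ord0 /u /v /=; ring.
have gen : generic sigma u v (affF \o X) (affF \o Y).
  have kX i : affk (X i) = 1 by case: i => [[|[|[|i]]] Hi].
  have kY i : affk (Y i) = 1 by case: i => [[|[|[|i]]] Hi].
  split=> /= [i|i||i j uv m].
  - by rewrite -[LHS]/(sigma (affF (X i))) sigma_affF kX.
  - by rewrite -[LHS]/(sigma (affF (Y i))) sigma_affF kY.
  - rewrite !big_ord_recr !big_ord0 /= !(affFD, affFB).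
    rewrite -[aconst 2%:R]/(aconst 2%:~R) affF_int; ring.
  (* The coefficient of [n] in [x i - y j + m] is [u i - v j]. *)
  - rewrite -affFB -affF_int -affFD; apply: affF_neq0 => /=.
    by rewrite addr0 subr_eq0; exact/eqP.
have D012 : distinct3 (@Ordinal 3 0 isT) (@Ordinal 3 1 isT) (@Ordinal 3 2 isT) by [].
have := telescopes_shift_ratio bal gen; congr telescopes.
- rewrite (kquot3 _ _ D012 D012) /F0 /= !pochE !(rising0, rising1) expr0z mul1r.
  by rewrite !mulr1 invr1 mulr1 !mulrA.
congr (_ - 1); rewrite (shift_ratio3 _ _ _ _ D012 D012) !mxE /F0 /u /v /X /Y /row3 /= !pochE.
(* The factor [Gamma(f - c)] of [F0], where [f = a+b+c-d-e+2], is traded by the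
   reflection formula for [1 / Gamma(c - f + 1)]; likewise for [a] and [b]. *)
have Z s t : rising (affF (aadd (asub s t) (aconst 1))) (affn s - affn t + 0) =
    rising (affF (aadd s k) - affF (aadd t k) + 1) (affn s + K - (affn t + K)).
  rewrite affFD affFB -[aconst 1]/(aconst 1%:~R) affF_int !affFD.
  by congr rising; ring.
rewrite (Z ea ed) (Z ea ee) (Z eb ed) (Z eb ee) (Z ec ed) (Z ec ee) /=.
have W s t z : affF s = 1 - z -> affn s = - t -> rising (affF s) (affn s) =
    (-1) ^ t / rising z t.
  by move=> -> ->; rewrite rising_refl.
have e2 : affF (aconst 2%:R) = 2%:R by exact: (affF_int 2).
set fk := aadd ef k.
set s1 := aadd (asub (asub (aadd ea eb) ed) ee) _.
set s2 := aadd (asub (asub (aadd ea ec) ed) ee) _.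
set s3 := aadd (asub (asub (aadd eb ec) ed) ee) _.
have W1 := W s1 (affn ec + K - affn fk) (affF (aadd ec k) - affF fk + 1).
have W2 := W s2 (affn eb + K - affn fk) (affF (aadd eb k) - affF fk + 1).
have W3 := W s3 (affn ea + K - affn fk) (affF (aadd ea k) - affF fk + 1).
rewrite W1 ?W2 ?W3 /s1 /s2 /s3 /fk /ef ?(affFD, affFB, e2) /=; try ring.
do 15! move: (rising _ _) => ?.
set n0 := (D + E)%R; set n1 := (A + K - _)%R; set n2 := (B + K - _)%R; set n3 := (C' + K - _)%R.
(* The prefactor of sign exponent [d + e] cancels the three reflection signs: their exponents add up
   to [3(D + E) - 2(A + B + C')], of the parity of [D + E]. *)
have sgn : (-1) ^ n0 * (-1) ^ n1 * (-1) ^ n2 * (-1) ^ n3 = 1 :> ratfun C.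
  have nz : (-1 : ratfun C) != 0 by rewrite oppr_eq0 oner_neq0.
  rewrite -!(expfzDr _ _ nz).
  have -> : n0 + n1 + n2 + n3 = 2 * (D + E + D + E - A - B - C').
    by rewrite /n0 /n1 /n2 /n3; ring.
  by rewrite -exprz_exp -[(-1) ^ 2]exprnP sqrrN expr1n exp1rz.
rewrite -[LHS]mul1r -[X in X * _]sgn !invfM.
move: ((-1) ^ n0) ((-1) ^ n1) ((-1) ^ n2) ((-1) ^ n3) => *; ring.
Qed.

End Seed.

(* C = R[i] (complex numbers over a real type R) *)
Theorem theorem1 (R : realType) : WZ_seed5 (@F0 R[i]).
Proof. exact: F0_seed. Qed.
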